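(* Let $\alpha\in(0,1)\cup(1,2)$ and let $\beta\in\mathbb{R}$ satisfy $\beta<\alpha+1$ and $\beta-\alpha\notin\mathbb{Z}_{\le 0}$. Define $$\tau(\alpha,\beta)=\begin{cases}\left|\dfrac{\Gamma(-\alpha+\beta)\,\Gamma(2\alpha-\beta+1)}{\pi}\right|^{1/\alpha}, & \alpha\in(0,1/2]\cup[3/2,2),\\[2ex] \left|\dfrac{\Gamma(-\alpha+\beta)\,\Gamma(2\alpha-\beta+1)}{\pi\sin(\pi\alpha)}\right|^{1/\alpha}, & \alpha\in(1/2,1)\cup(1,3/2).\end{cases}$$ Then for every $\varepsilon>0$, $$|f_{\alpha,\beta-\alpha}(t)|<\varepsilon\left|\frac{t^{-\alpha+\beta-1}}{\Gamma(-\alpha+\beta)}\right|\qquad\text{for all } t>\varepsilon^{-1/\alpha}\,\tau(\alpha,\beta).$$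
   Context: For $\alpha\in(0,1)\cup(1,2)$, $b<\alpha+1$ and $t>0$, $$f_{\alpha,b}(t)=\frac{-1}{\pi}\int_0^\infty e^{-zt}z^{\alpha-b}\,\mathrm{Im}\!\left(\frac{e^{i\pi(\alpha-b)}}{z^\alpha e^{i\pi\alpha}+1}\right)dz.$$ In the claim this is used with $b=\beta-\alpha$. *)

(* Defs.v *)
(* MathComp / MathComp-Analysis, over an arbitrary [R : realType]. *)
From mathcomp Require Import all_boot all_order all_algebra.
From mathcomp Require Import all_classical all_reals all_analysis.
From mathcomp.real_closed Require Import complex.

Set Implicit Arguments.
Unset Strict Implicit.
Unset Printing Implicit Defensive.
Import Order.TTheory GRing.Theory Num.Theory.
Import numFieldNormedType.Exports.
Local Open Scope classical_set_scope.
Local Open Scope ring_scope.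
Local Open Scope complex_scope.

(* Euler's integral; it converges only for [0 < x]. *)
Definition euler_gamma (R : realType) (x : R) : R :=
  \int[@lebesgue_measure R]_(u in `]0, +oo[) (u `^ (x - 1) * expR (- u)).

(* The Gamma function on the real line, continued to negative non-integers by
   Gamma x = Gamma (x + n) / (x (x + 1) ... (x + n - 1)), where [n] is the least
   natural number with [0 < x + n].  At the poles 0, -1, -2, ... one factor
   vanishes and the value is the junk [0]. *)
Definition Gamma (R : realType) (x : R) : R :=
  let n := if 0 < x then 0%N else (Num.truncn (- x)).+1 in
  euler_gamma (x + n%:R) / \prod_(i < n) (x + i%:R).

(* [expi theta] is e^(i theta). *)
Definition expi (R : realType) (theta : R) : R[i] := cos theta +i* sin theta.

(* For [0 < alpha < 2], [alpha != 1], [b < alpha + 1] and [0 < t], the integral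
   is absolutely convergent and the denominator does not vanish. *)
Definition f_alpha_b (R : realType) (alpha b t : R) : R :=
  (-1) / pi *
  \int[@lebesgue_measure R]_(z in `]0, +oo[)
    (expR (- (z * t)) * z `^ (alpha - b) *
     complex.Im (expi (pi * (alpha - b)) /
                 ((z `^ alpha)%:C * expi (pi * alpha) + 1))).

(* For [alpha] in (0,1) u (1,2), the second branch is the case
   (1/2,1) u (1,3/2). *)
Definition tau (R : realType) (alpha beta : R) : R :=
  if (0 < alpha <= 1 / 2) || (3 / 2 <= alpha < 2) then
    `| Gamma (- alpha + beta) * Gamma (2 * alpha - beta + 1) / pi | `^ (1 / alpha)
  else
    `| Gamma (- alpha + beta) * Gamma (2 * alpha - beta + 1) /
       (pi * sin (pi * alpha)) | `^ (1 / alpha).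

(* Main.v *)
Require Import Defs.
From mathcomp Require Import all_boot all_order all_algebra.
From mathcomp Require Import all_classical all_reals all_analysis.
From mathcomp Require Import measurable_realfun.
From mathcomp.real_closed Require Import complex.
From mathcomp Require Import ring lra.
Import Order.TTheory GRing.Theory Num.Theory.
Import numFieldNormedType.Exports.
Local Open Scope classical_set_scope.
Local Open Scope ring_scope.

(** Put [b = beta - alpha] and [s = alpha - b = 2 alpha - beta], so that
    [s + 1 > 0].  The integrand of [f_alpha_b alpha b t] is
    [e^(-zt) z^s Im (w / d)], where [w] is a unit complex number and
    [d = z^alpha e^(i pi alpha) + 1] lies on the ray that starts at [1] in the
    direction [e^(i pi alpha)].  The distance from [0] to that ray is bounded
    below by [c = 1] when [cos (pi alpha) >= 0], and by
    [c = |sin (pi alpha)| > 0] otherwise ([ray_gap_le], [ray_gap_gt0]); these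
    are the two cases of [tau].  So [|Im (w / d)| <= 1 / c]
    ([abs_Im_expi_div_le]), and
    [|f_alpha_b alpha b t| <= (pi c)^-1 * (integral of e^(-zt) z^s over z > 0)
      = Gamma (s + 1) t^-(s + 1) / (pi c)]
    ([f_alpha_b_le]).  On the other side,
    [tau^alpha = |Gamma b| Gamma (s + 1) / (pi c)] ([tauE]), and the hypothesis
    on [t] says that [tau^alpha < eps t^alpha]; the two facts combine to the
    claim because [alpha - (s + 1) = beta - alpha - 1].

    The analysis underneath is that Euler's integral converges and is positive
    for a positive argument ([integrable_gamma], [euler_gamma_gt0]), that
    [Gamma] does not vanish off its poles ([Gamma_neq0]), and the Laplace
    transform of a power ([integral_laplace_powR]).  The functions integrated
    may blow up at [0], so the fundamental theorem of calculus and the change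
    of variables are applied on half-lines away from [0] and then carried to
    the open half-line by monotone convergence
    ([cvg_integral_pos_halfline]). *)

(** * Integrals over the open half-line *)

Lemma cvg_integral_pos_halfline (R : realType) (g : R -> R) (c : R) :
  0 < c -> measurable_fun (`]0%R, +oo[%classic : set R) g ->
  {in `]0, +oo[, forall x, 0 <= g x} ->
  (\int[@lebesgue_measure R]_(x in `[(c / n.+1%:R)%R, +oo[) (g x)%:E
     @[n --> \oo] -->
   \int[@lebesgue_measure R]_(x in `]0%R, +oo[) (g x)%:E)%E.
Proof.
move=> c0 mg g0.
have cn0 n : 0 < c / n.+1%:R by rewrite divr_gt0.
have sub n : `[c / n.+1%:R, +oo[%classic `<=` (`]0%R, +oo[%classic : set R).
  by move=> x /=; rewrite !in_itv/= !andbT; apply: lt_le_trans.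
have -> : `]0, +oo[%classic = \bigcup_n `[c / n.+1%:R, +oo[%classic :> set R.
  apply/seteqP; split => [x /=|x [n _ /sub//]].
  rewrite in_itv/= andbT => x0; exists (Num.truncn (c / x)) => //=.
  rewrite in_itv/= andbT ler_pdivrMr// mulrC -ler_pdivrMr//.
  exact/ltW/truncnS_gt.
apply: ge0_nondecreasing_set_cvg_integral => //.
- apply/nondecreasing_seqP => n; rewrite subsetEset => x /=.
  rewrite !in_itv/= !andbT; apply: le_trans.
  by rewrite ler_pM2l// lef_pV2 ?posrE// ler_nat.
- by move=> n; apply/measurable_EFinP; apply: measurable_funS mg.
- by move=> n x /sub x0; rewrite lee_fin g0.
Qed.

(** Linear change of variables [y = c x]. *)
Lemma integral_pos_halfline_scale (R : realType) (g : R -> R) (c : R) :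
  0 < c -> {in `]0, +oo[, continuous g} -> {in `]0, +oo[, forall x, 0 <= g x} ->
  (\int[@lebesgue_measure R]_(x in `]0%R, +oo[) (g x)%:E =
   \int[@lebesgue_measure R]_(x in `]0%R, +oo[) (g (c * x) * c)%:E)%E.
Proof.
move=> c0 cg g0.
have cc : continuous (fun x : R => c * x).
  by move=> x; apply: continuousM; [exact: cvg_cst|exact: cvg_id].
have cgc : {in `]0, +oo[, continuous (fun x => g (c * x) * c)}.
  move=> x; rewrite in_itv/= andbT => x0.
  apply: continuousM; last exact: cvg_cst.
  apply: (@continuous_comp _ _ _ (fun x => c * x) g); first exact: cc.
  by apply: cg; rewrite in_itv/= andbT mulr_gt0.
have oc (h : R -> R) : {in `]0, +oo[, continuous h} ->
    measurable_fun (`]0%R, +oo[%classic : set R) h.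
  move=> ch; apply: open_continuous_measurable_fun => // x /set_mem.
  exact: ch.
(* Both sides are limits of integrals that agree term by term: [x >= 1/(n+1)]
   on the right corresponds to [y >= c/(n+1)] on the left. *)
have L := cvg_integral_pos_halfline _ _ _ c0 (oc _ cg) g0.
have P : {in `]0, +oo[, forall x, 0 <= g (c * x) * c}.
  move=> x; rewrite in_itv/= andbT => x0.
  by rewrite mulr_ge0 ?(ltW c0)// g0// in_itv/= andbT mulr_gt0.
have := cvg_integral_pos_halfline _ _ _ ltr01 (oc _ cgc) P.
apply: cvg_unique => //; apply: cvg_trans L.
apply: near_eq_cvg; apply: nearW => n /=.
have d (x : R) : is_derive x 1 (fun x => c * x) c.
  by apply: is_derive_eq; exact: mulr1.
have F'E : derive1 (fun x : R => c * x) = cst c.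
  by apply/funext => x; rewrite derive1E derive_val.
have n0 : 0 < 1 / n.+1%:R :> R by rewrite divr_gt0.
have cn0 : 0 < c / n.+1%:R by rewrite divr_gt0.
have cE : c / n.+1%:R = c * (1 / n.+1%:R) by rewrite mul1r.
rewrite cE.
rewrite (@increasing_ge0_integration_by_substitutiony _ (fun x => c * x)) -?cE.
- apply: eq_integral => x _; congr (_%:E).
  by rewrite F'E.
- by move=> x y _ _; rewrite ltr_pM2l.
- by rewrite F'E => x _; exact: cvg_cst.
- by rewrite F'E; apply/cvg_ex; exists c; exact: cvg_cst.
- by rewrite F'E; apply/cvg_ex; exists c; exact: cvg_cst.
- split; first by move=> x _; exact: (@ex_derive _ _ _ _ _ _ _ (d x)).
  by apply: cvg_at_right_filter; exact: cc.
- by apply: gt0_cvgMry => //; exact: cvg_id.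
- apply/continuous_within_itvcyP; split => [x|].
    rewrite in_itv/= andbT => x0; apply: cg.
    by rewrite in_itv/= andbT (lt_trans cn0).
  by apply: cvg_at_right_filter; apply: cg; rewrite in_itv/= andbT.
- move=> x; rewrite in_itv/= andbT => x0; apply: g0.
  by rewrite in_itv/= andbT (lt_trans cn0).
Qed.

(** * The Gamma function *)

Lemma continuous_powR (R : realType) (p x : R) :
  0 < x -> {for x, continuous (fun u : R => u `^ p)}.
Proof.
move=> x0; apply/differentiable_continuous/derivable1_diffP.
by apply: derivable_powR; rewrite in_itv/= andbT.
Qed.

Lemma continuous_gamma_integrand (R : realType) (p : R) :
  {in `]0, +oo[, continuous (fun u : R => u `^ p * expR (- u))}.
Proof.
move=> x; rewrite in_itv/= andbT => x0.
apply: (@continuousM _ _ (fun u : R => u `^ p) (fun u => expR (- u))).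
  exact: continuous_powR.
apply: (@continuous_comp _ _ _ (fun u : R => - u) expR).
  by apply: continuousN; exact: cvg_id.
exact: continuous_expR.
Qed.

(** With [y = u / (2 x)], this is the [x]-th power of [y <= e^y]. *)
Lemma powR_le_expR (R : realType) (x u : R) : 0 < x -> 0 <= u ->
  u `^ x <= (2 * x) `^ x * expR (u / 2).
Proof.
move=> x0 u0; have x20 : 0 < 2 * x by rewrite mulr_gt0.
have {1}-> : u = 2 * x * (u / (2 * x)) by rewrite mulrC divfK// gt_eqF.
rewrite (powRM _ (ltW x20) (divr_ge0 u0 (ltW x20))).
rewrite ler_wpM2l ?powR_ge0//.
have -> : u / 2 = u / (2 * x) * x by field; rewrite gt_eqF.
rewrite expRM ge0_ler_powR ?nnegrE ?(ltW x0) ?expR_ge0 ?divr_ge0 ?(ltW x20)//.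
by apply: le_trans (expR_ge1Dx _); rewrite lerDr.
Qed.

Lemma powR_cvgy (R : realType) (x : R) : 0 < x ->
  u `^ x @[u --> +oo] --> (+oo : set_system R).
Proof.
move=> x0; apply/cvgryPge => A; near=> u.
have h : `|A| `^ x^-1 <= u by near: u; exact: nbhs_pinfty_ge.
apply: (le_trans (ler_norm A)).
rewrite -[X in X <= _](powRr1 (normr_ge0 A)) -(mulVf (lt0r_neq0 x0)) powRrM.
by rewrite ge0_ler_powR ?nnegrE ?powR_ge0 ?(le_trans _ h) ?(ltW x0).
Unshelve. all: by end_near. Qed.

(** The integrand is dominated by a multiple of the derivative of the bounded
    function [-1 / (1 + u^x)], both near [0] and near infinity. *)
Lemma integrable_gamma (R : realType) (x : R) : 0 < x ->
  (@lebesgue_measure R).-integrable `]0%R, +oo[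
    (EFin \o (fun u : R => u `^ (x - 1) * expR (- u))).
Proof.
move=> x0.
pose g (u : R) := u `^ (x - 1) * expR (- u).
have g0 u : 0 <= g u by rewrite mulr_ge0 ?powR_ge0 ?expR_ge0.
have mg : measurable_fun (`]0%R, +oo[%classic : set R) g.
  apply: open_continuous_measurable_fun => // u /set_mem.
  exact: continuous_gamma_integrand.
apply/integrableP; split; first exact/measurable_EFinP.
pose F (u : R) := - (1 + u `^ x)^-1.
pose f (u : R) := x * u `^ (x - 1) / (1 + u `^ x) ^+ 2.
pose C := (1 + (2 * x) `^ x) ^+ 2 / x.
have pos u : 0 < 1 + u `^ x :> R by rewrite ltr_pwDl ?powR_ge0.
have dF (u : R) : 0 < u -> is_derive u 1 F (f u).
  move=> u0; rewrite /F.
  have d1 := is_derive1_powR x u0.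
  have d2 : is_derive u 1 (fun v : R => 1 + v `^ x) (x * u `^ (x - 1)).
    by have := is_deriveD (is_derive_cst (1 : R) u 1) d1; rewrite add0r.
  have d3 := @is_deriveV R (fun v : R => 1 + v `^ x) u _ 1
    (lt0r_neq0 (pos u)) d2.
  apply: is_derive_eq.
  by rewrite /f scaleNr opprK /GRing.scale/= mulrC.
(* [C] bounds [(1 + u^x)^2 e^(-u) / x], that is, [g / f]. *)
have gf u : 0 < u -> g u <= C * f u.
  move=> u0; rewrite /g /C /f.
  have K0 : 0 <= (2 * x) `^ x := powR_ge0 _ _.
  have B : (1 + u `^ x) ^+ 2 * expR (- u) <= (1 + (2 * x) `^ x) ^+ 2.
    have -> : expR (- u) = (expR (u / 2) ^+ 2)^-1.
      by rewrite expRN -expRM_natr divfK.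
    rewrite ler_pdivrMr ?exprn_gt0 ?expR_gt0// -exprMn lerXn2r ?nnegrE//.
    - exact: ltW.
    - by rewrite mulr_ge0 ?expR_ge0 ?addr_ge0.
    rewrite mulrDl mul1r lerD ?powR_le_expR ?(ltW u0)//.
    by apply: le_trans (expR_ge1Dx _); rewrite lerDl divr_ge0 ?(ltW u0).
  have -> : (1 + (2 * x) `^ x) ^+ 2 / x * (x * u `^ (x - 1) / (1 + u `^ x) ^+ 2)
    = u `^ (x - 1) * ((1 + (2 * x) `^ x) ^+ 2 / (1 + u `^ x) ^+ 2).
    by field; rewrite !gt_eqF.
  rewrite ler_wpM2l ?powR_ge0// ler_pdivlMr ?exprn_gt0//.
  by rewrite mulrC.
have C0 : 0 <= C by rewrite divr_ge0 ?sqr_ge0 ?ltW.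
have f0 u : 0 <= f u.
  by rewrite divr_ge0 ?sqr_ge0// mulr_ge0 ?powR_ge0 ?ltW.
have cf (u : R) : 0 < u -> {for u, continuous f}.
  move=> u0; apply: continuousM.
    by apply: continuousM; [exact: cvg_cst|exact: continuous_powR].
  apply: continuousV; first by rewrite expf_neq0// gt_eqF.
  apply: (@continuous_comp _ _ _ (fun v : R => 1 + v `^ x) (fun y => y ^+ 2)).
    by apply: continuousD; [exact: cvg_cst|exact: continuous_powR].
  exact: exprn_continuous.
have Fy : F u @[u --> +oo] --> (0 : R).
  rewrite -oppr0; apply: cvgN; apply/gtr0_cvgV0; first exact: nearW.
  apply: cvg_comp (powR_cvgy _ x x0) _; exact: cvg_addrl.
have mf : measurable_fun (`]0%R, +oo[%classic : set R) f.
  apply: open_continuous_measurable_fun => // u /set_mem /=.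
  by rewrite in_itv/= andbT; exact: cf.
have bnd (a : R) : 0 < a ->
    (\int[@lebesgue_measure R]_(u in `[a, +oo[) (g u)%:E <= C%:E)%E.
  move=> a0.
  have sub : `[a, +oo[%classic `<=` (`]0%R, +oo[%classic : set R).
    by move=> u /=; rewrite !in_itv/= !andbT; exact: lt_le_trans.
  have mfa : measurable_fun (`[a, +oo[%classic : set R) (EFin \o f).
    by apply/measurable_EFinP; exact: measurable_funS mf.
  apply: (@le_trans _ _
      (\int[@lebesgue_measure R]_(u in `[a, +oo[) (C%:E * (f u)%:E))%E).
    apply: ge0_le_integral => //.
    - by move=> u _; rewrite lee_fin.
    - by apply/measurable_EFinP; exact: measurable_funS mg.
    - by apply: measurable_funeM.
    - move=> u /sub /=; rewrite in_itv/= andbT => u0.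
      by rewrite lee_fin gf.
  rewrite ge0_integralZl_EFin//; last first.
    by move=> u _; rewrite lee_fin.
  rewrite (@ge0_continuous_FTC2y _ f F a 0)//.
  - rewrite -EFinB -EFinM lee_fin sub0r opprK ler_piMr// invf_le1//.
    by rewrite lerDl powR_ge0.
  - apply/continuous_within_itvcyP; split => [u|].
      by rewrite in_itv/= andbT => au; apply: cf; exact: lt_trans au.
    by apply: cvg_at_right_filter; exact: cf.
  - by move=> u au; exact: (@ex_derive _ _ _ _ _ _ _ (dF u (lt_trans a0 au))).
  - apply: cvg_at_right_filter.
    apply/differentiable_continuous/derivable1_diffP.
    exact: (@ex_derive _ _ _ _ _ _ _ (dF a a0)).
  - move=> u; rewrite in_itv/= andbT => au.
    rewrite derive1E.
    exact: (@derive_val _ _ _ _ _ _ _ (dF u (lt_trans a0 au))).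
apply: (@le_lt_trans _ _ C%:E); last exact: ltry.
have -> : (\int[@lebesgue_measure R]_(u in `]0%R, +oo[)
    `|(g u)%:E| =
    \int[@lebesgue_measure R]_(u in `]0%R, +oo[) (g u)%:E)%E.
  by apply: eq_integral => u _; rewrite gee0_abs ?lee_fin.
have L := cvg_integral_pos_halfline _ g 1 ltr01 mg (fun u _ => g0 u).
rewrite -(cvg_lim _ L)//; apply: lime_le.
  by apply/cvg_ex; eexists; exact: L.
by apply: nearW => n; apply: bnd; rewrite divr_gt0.
Qed.

(** The integrand is at least [e^(-2) / 2] on [[1, 2]]. *)
Lemma euler_gamma_gt0 (R : realType) (x : R) : 0 < x -> 0 < euler_gamma x.
Proof.
move=> x0; have ig := integrable_gamma _ _ x0.
pose g (u : R) := u `^ (x - 1) * expR (- u).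
have g0 u : 0 <= g u by rewrite mulr_ge0 ?powR_ge0 ?expR_ge0.
rewrite /euler_gamma.
have fi :
    (\int[@lebesgue_measure R]_(u in `]0%R, +oo[) (g u)%:E)%E \is a fin_num.
  exact: integrable_fin_num ig.
rewrite -lte_fin fineK//.
pose m : R := 2^-1 * expR (- 2).
have m0 : 0 < m by rewrite mulr_gt0 ?expR_gt0 ?invr_gt0.
have sub : `[1, 2]%classic `<=` (`]0%R, +oo[%classic : set R).
  by move=> u /=; rewrite !in_itv/= => /andP[u1 _]; rewrite (lt_le_trans _ u1).
have mg := measurable_int _ ig.
apply: (@lt_le_trans _ _
  (\int[@lebesgue_measure R]_(u in `[1%R, 2%R]) m%:E)%E).
  rewrite integral_cst//= lebesgue_measure_itv/= lte_fin ltr1n/= -EFinB -EFinM.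
  by rewrite lte_fin mulr_gt0// subr_gt0 ltr1n.
apply: (@le_trans _ _
  (\int[@lebesgue_measure R]_(u in `[1%R, 2%R]) (g u)%:E)%E).
  apply: ge0_le_integral => //.
  - by move=> u _; rewrite lee_fin ltW.
  - exact: measurable_funS mg.
  - move=> u /=; rewrite in_itv/= => /andP[u1 u2]; rewrite lee_fin.
    have u0 : 0 < u := lt_le_trans ltr01 u1.
    apply: ler_pM; rewrite ?expR_ge0 ?invr_ge0 ?ler_expR ?lerN2//.
    rewrite powRB; last by rewrite (gt_eqF u0) implybT.
    rewrite powRr1 ?(ltW u0)//.
    rewrite -[leLHS]mul1r ler_pM ?invr_ge0 ?lef_pV2 ?posrE//.
    by rewrite -(powRr0 u) ler_powR ?(ltW x0).
apply: ge0_subset_integral => //.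
by move=> u _; rewrite lee_fin.
Qed.

Lemma Gamma_neq0 (R : realType) (x : R) :
  (forall n : nat, x <> - n%:R) -> Gamma x != 0.
Proof.
move=> np; rewrite /Gamma /=; set n := (if _ then _ else _).
have xn0 : 0 < x + n%:R.
  rewrite /n; case: ifPn => [|_]; first by rewrite addr0.
  by rewrite -ltrBlDl sub0r truncnS_gt.
apply: mulf_neq0; first by rewrite gt_eqF ?euler_gamma_gt0.
rewrite invr_eq0; apply/prodf_neq0 => i _.
by rewrite addr_eq0; apply/eqP; exact: np.
Qed.

Lemma Gamma_euler (R : realType) (x : R) : 0 < x -> Gamma x = euler_gamma x.
Proof. by move=> x0; rewrite /Gamma x0 big_ord0 divr1 addr0. Qed.

(** The value is finite, hence so is the integral: with a nonnegative
    integrand, the equation also gives integrability. *)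
Lemma integral_laplace_powR (R : realType) (s t : R) : -1 < s -> 0 < t ->
  (\int[@lebesgue_measure R]_(z in `]0%R, +oo[) (expR (- (z * t)) * z `^ s)%:E =
   (t `^ (- (s + 1)) * euler_gamma (s + 1))%:E)%E.
Proof.
move=> s1 t0.
have ps : 0 < s + 1 by rewrite -ltrBlDr sub0r.
have ig := integrable_gamma _ _ ps.
have h0 (z : R) : 0 <= expR (- (z * t)) * z `^ s.
  by rewrite mulr_ge0 ?powR_ge0 ?expR_ge0.
have E : (\int[@lebesgue_measure R]_(u in `]0%R, +oo[)
    (u `^ (s + 1 - 1) * expR (- u))%:E = (t `^ (s + 1))%:E *
  \int[@lebesgue_measure R]_(z in `]0%R, +oo[)
    (expR (- (z * t)) * z `^ s)%:E)%E.
  rewrite (integral_pos_halfline_scale _ _ _ t0); last 2 first.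
  - exact: continuous_gamma_integrand.
  - by move=> u _; rewrite mulr_ge0 ?powR_ge0 ?expR_ge0.
  rewrite -ge0_integralZl_EFin ?powR_ge0//; last 2 first.
  - by move=> z _; rewrite lee_fin.
  - apply/measurable_EFinP/measurable_funTS/measurable_funM => //.
    apply: measurableT_comp => //; apply: measurableT_comp => //.
    exact: measurable_funM.
  apply: eq_integral => z; rewrite inE/= in_itv/= andbT => z0.
  rewrite -EFinM addrK; congr (_%:E).
  rewrite powRM ?ltW// powRD ?(gt_eqF t0) ?implybT// powRr1 ?ltW// (mulrC t z).
  ring.
rewrite /euler_gamma /Rintegral E; set I := (\int[_]_(z in _) _)%E.
have : (I \is a fin_num).
  have : (0 <= I)%E by apply: integral_ge0 => z _; rewrite lee_fin.
  have : (\int[@lebesgue_measure R]_(u in `]0%R, +oo[)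
      (u `^ (s + 1 - 1) * expR (- u))%:E)%E \is a fin_num.
    exact: integrable_fin_num ig.
  rewrite E -/I.
  have tp : 0 < t `^ (s + 1) by exact: powR_gt0.
  by case: (I) => //=; rewrite gt0_muley ?lte_fin.
move=> /fineK IE; rewrite -IE /= powRN mulrA mulVf ?mul1r//.
by rewrite gt_eqF// powR_gt0.
Qed.

(** * The imaginary part in the integrand *)

Lemma Im_expi_div (R : realType) (a b r : R) :
  complex.Im (expi a / (r%:C%C * expi b + 1)) =
  (sin a * (r * cos b + 1) - cos a * (r * sin b)) /
  ((r * cos b + 1) ^+ 2 + (r * sin b) ^+ 2).
Proof.
rewrite /expi /=.
rewrite !mul0r subr0 !addr0.
ring.
Qed.

(** [|Im w| <= |w|], for a quotient whose denominator has modulus at least [c]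
    and whose numerator has modulus [1]. *)
Lemma abs_Im_expi_div_le (R : realType) (a b r c : R) :
  0 < c -> c ^+ 2 <= (r * cos b + 1) ^+ 2 + (r * sin b) ^+ 2 ->
  `|complex.Im (expi a / (r%:C%C * expi b + 1))| <= c^-1.
Proof.
move=> c0; rewrite Im_expi_div.
set A := r * cos b + 1; set B := r * sin b; set D := A ^+ 2 + B ^+ 2 => cD.
have D0 : 0 < D by apply: lt_le_trans cD; rewrite exprn_gt0.
rewrite normrM normfV (gtr0_norm D0) ler_pdivrMr// ler_pdivlMl//.
rewrite -(ler_pXn2r (n := 2)) ?nnegrE ?mulr_ge0 ?(ltW D0) ?(ltW c0)//.
rewrite exprMn real_normK ?num_real// [leRHS]expr2.
apply: ler_pM; rewrite ?sqr_ge0//.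
(* [D] is the squared modulus of [e^(ia)] times the conjugate of the
   denominator, here split into imaginary and real parts. *)
have -> : D = (sin a * A - cos a * B) ^+ 2 + (cos a * A + sin a * B) ^+ 2.
  rewrite /D -[A ^+ 2 + B ^+ 2]mul1r -(cos2Dsin2 a); ring.
by rewrite lerDl sqr_ge0.
Qed.

Lemma continuous_Im_expi_div (R : realType) (a b r : R) :
  (r * cos b + 1) ^+ 2 + (r * sin b) ^+ 2 != 0 ->
  {for r, continuous
    (fun u : R => complex.Im (expi a / (u%:C%C * expi b + 1)))}.
Proof.
move=> D0; rewrite (_ : (fun _ => _) = fun u : R =>
  (sin a * (u * cos b + 1) - cos a * (u * sin b)) *
  ((u * cos b + 1) ^+ 2 + (u * sin b) ^+ 2)^-1); last first.
  by apply/funext => u; exact: Im_expi_div.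
have cA : (fun u : R => u * cos b + 1) u @[u --> r] --> r * cos b + 1.
  by apply: cvgD; [apply: cvgM; [exact: cvg_id|exact: cvg_cst]|exact: cvg_cst].
have cB : (fun u : R => u * sin b) u @[u --> r] --> r * sin b.
  by apply: cvgM; [exact: cvg_id|exact: cvg_cst].
apply: cvgM.
  apply: cvgB; apply: cvgM; do ?[exact: cvg_cst|exact: cA|exact: cB].
by apply: cvgV => //; apply: cvgD; apply: cvgM.
Qed.

(** A lower bound for the distance from [0] to the ray
    [{1 + r e^(i pi alpha) : r >= 0}], with the same case distinction as in
    [tau].  In the first case [cos (pi alpha) >= 0] and the nearest point is
    [1] itself; in the second the bound is the distance to the whole line. *)
Definition ray_gap {R : realType} (alpha : R) : R :=
  if (0 < alpha <= 1 / 2) || (3 / 2 <= alpha < 2) then 1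
  else `|sin (pi * alpha)|.

Lemma ray_gap_gt0 (R : realType) (alpha : R) :
  0 < alpha < 1 \/ 1 < alpha < 2 -> 0 < ray_gap alpha.
Proof.
move=> h; rewrite /ray_gap; case: ifP => // _; rewrite normr_gt0.
have p0 := pi_gt0 R.
case: h => /andP[h1 h2].
  by rewrite gt_eqF// sin_gt0_pi ?mulr_gt0// gtr_pMr.
rewrite (_ : pi * alpha = pi * (alpha - 1) + pi); last by ring.
rewrite sinDpi oppr_eq0 gt_eqF// sin_gt0_pi// pmulr_rgt0// subr_gt0 h1/=.
by rewrite gtr_pMr// ltrBlDr.
Qed.

Lemma ray_gap_le (R : realType) (alpha r : R) : 0 <= r ->
  ray_gap alpha ^+ 2 <=
  (r * cos (pi * alpha) + 1) ^+ 2 + (r * sin (pi * alpha)) ^+ 2.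
Proof.
move=> r0; have p0 := pi_gt0 R.
have -> : (r * cos (pi * alpha) + 1) ^+ 2 + (r * sin (pi * alpha)) ^+ 2 =
   r ^+ 2 * (cos (pi * alpha) ^+ 2 + sin (pi * alpha) ^+ 2)
   + 2 * r * cos (pi * alpha) + 1 by ring.
rewrite cos2Dsin2 mulr1 /ray_gap; case: ifP => [h|_].
  have c0 : 0 <= cos (pi * alpha).
    case/orP: h => /andP[h1 h2].
      by rewrite cos_ge0_pihalf//; apply/andP; split; nra.
    rewrite (_ : pi * alpha = - (pi * (2 - alpha)) + pi *+ 2); last by ring.
    rewrite cosD2pi cosN cos_ge0_pihalf//; apply/andP; split; nra.
  by rewrite expr1n lerDr addr_ge0 ?sqr_ge0// !mulr_ge0.
rewrite real_normK ?num_real// -subr_ge0.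
have -> : r ^+ 2 + 2 * r * cos (pi * alpha) + 1 - sin (pi * alpha) ^+ 2 =
   (r + cos (pi * alpha)) ^+ 2 by rewrite sin2cos2; ring.
exact: sqr_ge0.
Qed.

(** * The bound on [f_alpha_b] *)

Lemma f_alpha_b_le (R : realType) (alpha b t : R) :
  0 < alpha < 1 \/ 1 < alpha < 2 -> b < alpha + 1 -> 0 < t ->
  `|f_alpha_b alpha b t| <=
    t `^ (- (alpha - b + 1)) * euler_gamma (alpha - b + 1) /
    (pi * ray_gap alpha).
Proof.
move=> ha hb t0; set s := alpha - b.
have s1 : -1 < s by rewrite /s; lra.
have c0 := ray_gap_gt0 _ _ ha; have p0 := pi_gt0 R.
pose h (z : R) := expR (- (z * t)) * z `^ s.
have h0 z : 0 <= h z by rewrite mulr_ge0 ?powR_ge0 ?expR_ge0.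
have Ih := integral_laplace_powR _ _ _ s1 t0.
have mexp : measurable_fun [set: R] (fun z : R => expR (- (z * t))).
  by do 2 (apply: measurableT_comp => //); exact: measurable_funM.
have mh : measurable_fun [set: R] h by apply: measurable_funM.
have ih : (@lebesgue_measure R).-integrable `]0%R, +oo[ (EFin \o h).
  apply/integrableP; split; first exact/measurable_EFinP/measurable_funTS.
  have -> : (\int[@lebesgue_measure R]_(z in `]0%R, +oo[) `|(h z)%:E| =
      \int[@lebesgue_measure R]_(z in `]0%R, +oo[) (h z)%:E)%E.
    by apply: eq_integral => z _; rewrite gee0_abs ?lee_fin.
  by rewrite Ih ltry.
pose I (z : R) := complex.Im (expi (pi * s) /
  ((z `^ alpha)%:C%C * expi (pi * alpha) + 1)).
have Ile z : `|I z| <= (ray_gap alpha)^-1.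
  by apply: abs_Im_expi_div_le => //; apply: ray_gap_le; exact: powR_ge0.
have mI : measurable_fun (`]0%R, +oo[%classic : set R) I.
  apply: open_continuous_measurable_fun => // z /set_mem /=.
  rewrite in_itv/= andbT => z0.
  apply: (@continuous_comp _ _ _ (fun z : R => z `^ alpha)
    (fun u => complex.Im (expi (pi * s) / (u%:C%C * expi (pi * alpha) + 1)))).
    exact: continuous_powR.
  apply: continuous_Im_expi_div; rewrite gt_eqF//.
  apply: lt_le_trans (ray_gap_le _ _ _ (powR_ge0 z alpha)).
  by rewrite exprn_gt0.
have hI z : `|h z * I z| <= (ray_gap alpha)^-1 * h z.
  by rewrite normrM ger0_norm// mulrC ler_wpM2r.
have ihc : (@lebesgue_measure R).-integrable `]0%R, +oo[
    (EFin \o (fun z => (ray_gap alpha)^-1 * h z)).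
  exact: integrableZl ih.
have ihI : (@lebesgue_measure R).-integrable `]0%R, +oo[
    (EFin \o (fun z => h z * I z)).
  apply: le_integrable ihc => //.
    apply/measurable_EFinP/measurable_funM => //.
    exact: measurable_funTS.
  move=> z _; rewrite /= lee_fin; apply: le_trans (hI z) _.
  exact: ler_norm.
have ihIn : (@lebesgue_measure R).-integrable `]0%R, +oo[
    (EFin \o (fun z => `|h z * I z|)) by exact: integrable_norm ihI.
rewrite /f_alpha_b -/s normrM.
have -> : `|-1 / pi| = pi^-1 :> R.
  by rewrite normrM normrN1 mul1r gtr0_norm ?invr_gt0.
rewrite invfM mulrCA ler_pM2l ?invr_gt0//.
apply: le_trans (le_normr_Rintegral _ ihI) _ => //.
apply: le_trans (le_Rintegral _ ihIn ihc (fun z _ => hI z)) _ => //.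
by rewrite RintegralZl// /Rintegral Ih mulrC.
Qed.

(** Both cases of [tau] in one formula, with the absolute values of the positive
    factors removed. *)
Lemma tauE (R : realType) (alpha beta : R) : beta < alpha + 1 ->
  0 < alpha < 1 \/ 1 < alpha < 2 ->
  tau alpha beta = (`|Gamma (- alpha + beta)| *
    euler_gamma (2 * alpha - beta + 1) / (pi * ray_gap alpha)) `^ (1 / alpha).
Proof.
move=> hb ha; have p0 := pi_gt0 R.
have x0 : 0 < 2 * alpha - beta + 1 by case: ha => /andP[]; lra.
have g0 := euler_gamma_gt0 _ _ x0.
rewrite /tau /ray_gap (Gamma_euler _ _ x0); case: ifP => _;
  by rewrite normrM normfV !normrM (gtr0_norm g0) (gtr0_norm p0) ?mulr1.
Qed.

Theorem theorem12 (R : realType) (alpha beta : R)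
    (halpha : 0 < alpha < 1 \/ 1 < alpha < 2)
    (hbeta : beta < alpha + 1)
    (hpole : forall n : nat, beta - alpha <> - n%:R)
    (eps : R) (heps : 0 < eps)
    (t : R) (ht : eps `^ (- 1 / alpha) * tau alpha beta < t) :
  `| f_alpha_b alpha (beta - alpha) t |
    < eps * `| t `^ (- alpha + beta - 1) / Gamma (- alpha + beta) |.
Proof.
have a0 : 0 < alpha by case: halpha => /andP[]; lra.
have p0 := pi_gt0 R; have c0 := ray_gap_gt0 _ _ halpha.
have s0 : 0 < 2 * alpha - beta + 1 by lra.
have g0 := euler_gamma_gt0 _ _ s0.
have G0 : Gamma (- alpha + beta) != 0 by apply: Gamma_neq0; rewrite addrC.
have nG0 : 0 < `|Gamma (- alpha + beta)| by rewrite normr_gt0.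
move: ht; rewrite tauE//; set M := `|_| * _ / _ => ht.
have M0 : 0 < M by rewrite divr_gt0 ?mulr_gt0.
have t0 : 0 < t by apply: le_lt_trans ht; rewrite mulr_ge0 ?powR_ge0.
have Mt : M < eps * t `^ alpha.
  rewrite -ltr_pdivrMl//.
  have : (eps `^ (- 1 / alpha) * M `^ (1 / alpha)) `^ alpha < t `^ alpha.
    have nt : t \is Num.nneg by rewrite nnegrE ltW.
    apply: (gt0_ltr_powR a0 _ nt ht); rewrite nnegrE.
    by rewrite mulr_ge0 ?powR_ge0.
  rewrite (powRM _ (powR_ge0 _ _) (powR_ge0 _ _)).
  rewrite -!powRrM.
  rewrite !(divfK (lt0r_neq0 a0)).
  by rewrite powRr1 ?(ltW M0)// powR_inv1 ?ltW.
have hb : beta - alpha < alpha + 1 by lra.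
apply: le_lt_trans (f_alpha_b_le _ _ _ _ halpha hb t0) _.
have -> : alpha - (beta - alpha) + 1 = 2 * alpha - beta + 1 by ring.
rewrite normrM normfV (ger0_norm (powR_ge0 _ _)) mulrA ltr_pdivlMr//.
have -> : - alpha + beta - 1 = alpha + - (2 * alpha - beta + 1) by ring.
rewrite powRD ?(gt_eqF t0) ?implybT// mulrA.
have -> : t `^ (- (2 * alpha - beta + 1)) * euler_gamma (2 * alpha - beta + 1) /
  (pi * ray_gap alpha) * `|Gamma (- alpha + beta)| =
  M * t `^ (- (2 * alpha - beta + 1)) by rewrite /M; ring.
by rewrite ltr_pM2r// powR_gt0.
Qed.
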